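(* For all integers $\ell\geq 3$ and $k\geq 3$, \[ \mathrm{sat}_k(n,\text{Berge-}K_\ell)\sim\frac{\ell-2}{k-1}\,n \quad\text{as } n\to\infty, \] i.e. $\mathrm{sat}_k(n,\text{Berge-}K_\ell)=(1+o(1))\frac{\ell-2}{k-1}n$, where $k,\ell$ are fixed.
   Context: Let $F$ be a graph and $\mathcal{H}$ a hypergraph. $\mathcal{H}$ is a Berge-$F$ if $F$ and $\mathcal{H}$ can be embedded on a common vertex set so that there is a bijection $\phi:E(F)\to E(\mathcal{H})$ with $e\subseteq\phi(e)$ for every $e\in E(F)$. A hypergraph contains a Berge-$F$ if some subhypergraph (subset of its edges) is a Berge-$F$. A $k$-uniform hypergraph $\mathcal{H}$ on $n$ vertices is Berge-$F$-saturated if it contains no Berge-$F$, but for every $k$-subset $e$ of $V(\mathcal{H})$ with $e\notin E(\mathcal{H})$, the hypergraph $\mathcal{H}+e$ contains a Berge-$F$. The saturation number $\mathrm{sat}_k(n,\text{Berge-}F)$ is the minimum number of edges of a Berge-$F$-saturated $k$-uniform hypergraph on $n$ vertices. $K_\ell$ denotes the complete graph on $\ell$ vertices. *)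

(* Defs.v *)
From mathcomp Require Import all_boot.
From mathcomp Require Import boolp.

Set Implicit Arguments.
Unset Strict Implicit.
Unset Printing Implicit Defensive.

(* A (hyper)graph on a finite vertex type V is represented by its edge set
   E : {set {set V}}; a graph is a 2-uniform hypergraph. *)

Definition uniform (V : finType) (k : nat) (H : {set {set V}}) : Prop :=
  forall e, e \in H -> #|e| = k.

Definition complete_graph (l : nat) : {set {set 'I_l}} :=
  [set e : {set 'I_l} | #|e| == 2].

(* W is the common vertex set, f and g are the embeddings of the vertices of
   F and of H into it. *)
Definition berge (T V : finType) (F : {set {set T}}) (H : {set {set V}}) :
    Prop :=
  exists (W : finType) (f : T -> W) (g : V -> W) (phi : {set T} -> {set V}),
  [/\ injective f, injective g, {in F &, injective phi}, phi @: F = H &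
      forall e, e \in F -> f @: e \subset g @: phi e].

Definition contains_berge (T V : finType) (F : {set {set T}})
    (H : {set {set V}}) : Prop :=
  exists H' : {set {set V}}, H' \subset H /\ berge F H'.

Definition berge_saturated (T V : finType) (F : {set {set T}}) (k : nat)
    (H : {set {set V}}) : Prop :=
  [/\ uniform k H, ~ contains_berge F H &
      forall e : {set V}, #|e| = k -> e \notin H -> contains_berge F (e |: H)].

(* The default set0 of the argmin is irrelevant as soon as a saturated
   hypergraph exists, e.g., when F has an edge: see berge_satP. *)
Definition berge_sat (k n : nat) (T : finType) (F : {set {set T}}) : nat :=
  #|[arg min_(H < (set0 : {set {set 'I_n}}) | `[< berge_saturated F k H >])
       #|H|]|.

Lemma berge_saturated_exists (T V : finType) (F : {set {set T}}) (k : nat) :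
  F != set0 -> exists H : {set {set V}}, berge_saturated F k H.
Proof.
move=> F0.
pose P (H : {set {set V}}) := `[< uniform k H /\ ~ contains_berge F H >].
have P0 : P set0.
  apply/asboolP; split=> [e|[H' []]]; first by rewrite inE.
  rewrite subset0 => /eqP -> [W [f [g [phi [_ _ _ im _]]]]].
  move/eqP: im; rewrite imset_eq0; exact/negP.
have [H /asboolP[uH nH] maxH] := arg_maxnP (fun H : {set {set V}} => #|H|) P0.
exists H; split=> // e ek eH; apply: contrapT => ne.
have /maxH : P (e |: H).
  by apply/asboolP; split=> // e'; rewrite !inE => /orP[/eqP -> //|/uH].
by rewrite /= cardsU1 eH add1n ltnn.
Qed.

Lemma berge_satP (k n : nat) (T : finType) (F : {set {set T}}) :
  F != set0 ->
  (exists2 H : {set {set 'I_n}}, berge_saturated F k H & #|H| = berge_sat k n F)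
  /\ forall H : {set {set 'I_n}}, berge_saturated F k H -> berge_sat k n F <= #|H|.
Proof.
move=> F0; have [H0 satH0] := @berge_saturated_exists T 'I_n F k F0.
rewrite /berge_sat /arg_min /extremum; case: pickP => [H|noH].
  move=> /andP[/asboolP satH /forallP minH]; split; first by exists H.
  by move=> H' /asboolP satH'; exact: (implyP (minH H')).
pose P (H : {set {set 'I_n}}) := `[< berge_saturated F k H >].
have PH0 : P H0 by apply/asboolP.
case: (arg_minnP (fun H : {set {set 'I_n}} => #|H|) PH0) => H PH minH.
have /negP[] := noH H; apply/andP; split=> //.
by apply/forallP => H'; apply/implyP => /minH.
Qed.

(* Main.v *)
Require Import Defs.
From mathcomp Require Import all_boot.
From mathcomp Require Import boolp zify.

Set Implicit Arguments.
Unset Strict Implicit.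
Unset Printing Implicit Defensive.

(** Lower bound.  Let H be saturated and call a vertex large if its degree
    exceeds a constant D.  Among k pairwise distant vertices, which do not form
    an edge, two are core vertices u, v of the clique created by adding them as
    an edge, and every other core vertex w is large: otherwise u and v would be
    at distance at most 2 through w.  So u lies on l-2 edges that meet the set
    of large vertices.  Hence all but O(1) of the non-large vertices lie on l-2
    such edges, each of which has at most k-1 non-large vertices; this gives
    (l-2) n <= (k-1) |H| + O(|H|/D) + O(1).

    Upper bound.  Take a set W of l-2 vertices and cover the other vertices by
    blocks of size k-1, pairwise disjoint except that between 2 and k of them
    share a vertex b (this absorbs the residue of n modulo k-1).  The edges are
    w + p for w in W and p a block, and {w, w'} + (G - b) for w, w' in W and a
    fixed block G containing b.  This has no Berge-K_l, and any further edge
    that meets a block avoiding b creates one.  So a maximal extension has only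
    O(1) additional edges. *)

(** * Berge cliques inside the vertex set: a core and edges for its pairs *)

Definition pairs (V : finType) (K : {set V}) : {set {set V}} :=
  [set s : {set V} | (s \subset K) && (#|s| == 2)].

(** A Berge-$K_\ell$ in [H] seen from its core [K]. The common vertex set and the subhypergraph
    disappear, and only the values of [psi] on [pairs K] matter. *)
Definition berge_clique (V : finType) (l : nat) (H : {set {set V}}) : Prop :=
  exists (K : {set V}) (psi : {set V} -> {set V}),
  [/\ #|K| = l, {in pairs K &, injective psi} &
      forall s, s \in pairs K -> psi s \in H /\ s \subset psi s].

Lemma pairsP (V : finType) (K s : {set V}) :
  reflect (exists x y, [/\ x \in K, y \in K, x != y & s = [set x; y]])
          (s \in pairs K).
Proof.
rewrite inE; apply: (iffP andP) => [[sK /cards2P[x [y [xy E]]]]|].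
  exists x, y; split=> //; apply: (subsetP sK); rewrite E ?set21 //.
  by rewrite set22.
move=> [x [y [xK yK xy ->]]]; split; last by rewrite cards2 xy.
by apply/subsetP => z /set2P[] ->.
Qed.

Lemma mem_pairs (V : finType) (K : {set V}) x y :
  x \in K -> y \in K -> x != y -> [set x; y] \in pairs K.
Proof. by move=> xK yK xy; apply/pairsP; exists x, y. Qed.

Lemma card_pairs (V : finType) (K : {set V}) : #|pairs K| = 'C(#|K|, 2).
Proof. exact: cards_draws. Qed.

Lemma set2_eq (V : finType) (x y z t : V) : [set x; y] = [set z; t] ->
  (x = z /\ y = t) \/ (x = t /\ y = z).
Proof.
move=> E.
have /set2P hx : x \in [set z; t] by rewrite -E set21.
have /set2P hy : y \in [set z; t] by rewrite -E set22.
have /set2P hz : z \in [set x; y] by rewrite E set21.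
have /set2P ht : t \in [set x; y] by rewrite E set22.
by intuition congruence.
Qed.

(** Pulling the vertices of the clique back along [g] gives the core. Conversely, an enumeration of
    [K] embeds $K_\ell$ into [V] itself, and the values of [psi] on pairs form the subhypergraph. *)
Lemma berge_cliqueP (V : finType) (l : nat) (H : {set {set V}}) : 2 <= l ->
  contains_berge (complete_graph l) H <-> berge_clique l H.
Proof.
move=> l2; split.
- move=> [H' [sub [W [f [g [phi [injf injg injphi im cov]]]]]]].
  (* As [2 <= l], the vertex [i] lies on an edge of the clique, whose representative covers [f i];
     so [f i] comes from [V]. *)
  have fg i : exists v, g v = f i.
    have [j ij] : exists j : 'I_l, i != j.
      apply/existsP; apply: contraTT l2; rewrite negb_exists => /forallP h.
      rewrite -ltnNge -[l]card_ord; apply: leq_ltn_trans (ltnSn 1).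
      rewrite -cardsT -(cards1 i); apply: subset_leq_card.
      by apply/subsetP => j _; rewrite inE eq_sym -[_ == _]negbK h.
    have /cov/subsetP/(_ (f i)) : [set i; j] \in complete_graph l.
      by rewrite inE cards2 ij.
    by rewrite imset_f ?set21// => /(_ isT)/imsetP[v _ ->]; exists v.
  have [c cE] := choice fg.
  have injc : injective c by move=> i j E; apply: injf; rewrite -!cE E.
  have imc (s : {set V}) : s \subset c @: [set: 'I_l] -> s = c @: (c @^-1: s).
    move=> sK; apply/setP => x; apply/idP/imsetP => [xs|[i]].
      have /imsetP[i _ xi] := subsetP sK _ xs.
      by exists i => //; rewrite inE -xi.
    by rewrite inE => ? ->.
  have pre (s : {set V}) : s \in pairs (c @: [set: 'I_l]) ->
      s = c @: (c @^-1: s) /\ c @^-1: s \in complete_graph l.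
    rewrite inE => /andP[/imc E s2]; split=> //.
    by rewrite inE -(card_imset _ injc) -E.
  exists (c @: [set: 'I_l]), (fun s : {set V} => phi (c @^-1: s)); split.
  + by rewrite card_imset // cardsT card_ord.
  + move=> s t /pre[Es s2] /pre[Et t2] E.
    by rewrite Es Et (injphi _ _ s2 t2 E).
  + move=> s /pre[E s2]; split.
      by apply: (subsetP sub); rewrite -im imset_f.
    apply/subsetP => x; rewrite {1}E => /imsetP[i ii ->].
    have /cov/subsetP/(_ (f i)) := s2.
    rewrite imset_f // => /(_ isT)/imsetP[v vp]; rewrite -cE => /injg ->.
    exact: vp.
- move=> [K [psi [cK inj h]]].
  pose c (i : 'I_l) : V := enum_val (cast_ord (esym cK) i).
  have injc : injective c by move=> i j /enum_val_inj/cast_ord_inj.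
  have cF s : s \in complete_graph l -> c @: s \in pairs K.
    rewrite !inE card_imset // => ->; rewrite andbT.
    by apply/subsetP => x /imsetP[i _ ->]; exact: enum_valP.
  exists ((fun s : {set 'I_l} => psi (c @: s)) @: complete_graph l); split.
    by apply/subsetP => e /imsetP[s /cF/h[? _] ->].
  exists V, c, id, (fun s : {set _} => psi (c @: s)); split=> //.
  + by move=> s t /cF sF /cF tF /(inj _ _ sF tF); exact: imset_inj.
  + by move=> s /cF/h[_]; rewrite imset_id.
Qed.

(** * The lower bound *)

Lemma leq_card_bigcup_const (T V : finType) (A : {set T}) (F : T -> {set V}) m :
  (forall x, x \in A -> #|F x| <= m) -> #|\bigcup_(x in A) F x| <= #|A| * m.
Proof.
move=> hF; rewrite -sum_nat_const; apply: (@leq_trans (\sum_(x in A) #|F x|)).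
  elim/big_rec2: _ => [|x s U _ le]; first by rewrite cards0.
  by rewrite (leq_trans (leq_card_setU _ _)) // leq_add2l.
exact: leq_sum.
Qed.

(** Greedy choice: take any [u] in [B], discard [r u], which costs at most [M] elements, and
    continue. Symmetry of [r] excludes [u] from [r v] for the vertices [v] chosen later. *)
Lemma independent_subset (V : finType) (r : V -> {set V}) (M j : nat)
    (B : {set V}) :
  0 < M -> (forall u, u \in B -> #|r u| <= M) -> (forall u, u \in r u) ->
  (forall u v, u \in B -> v \in B -> v \in r u -> u \in r v) -> j * M <= #|B| ->
  exists S : {set V}, [/\ S \subset B, #|S| = j &
    forall u v, u \in S -> v \in S -> u != v -> v \notin r u].
Proof.
move=> M0; elim: j B => [|j IH] B rM rr sym cB.
  exists set0; split; rewrite ?sub0set ?cards0 // => u v; by rewrite inE.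
have /card_gt0P[u uB] : 0 < #|B| by apply: leq_trans cB; rewrite mulSn ltn_addr.
have [S [SB cS indS]] : exists S : {set V}, [/\ S \subset B :\: r u, #|S| = j &
    forall u v, u \in S -> v \in S -> u != v -> v \notin r u].
  apply: IH => //.
  - by move=> v /setDP[/rM].
  - by move=> v w /setDP[vB _] /setDP[wB _]; exact: sym.
  - by have := cardsID (r u) B; have := subset_leq_card (subsetIr B (r u));
      have := rM u uB; lia.
have uS v : v \in S -> v \in B /\ v \notin r u.
  by move=> vS; have /setDP[] := subsetP SB _ vS.
exists (u |: S); split.
- by rewrite subUset sub1set uB (subset_trans SB) ?subsetDl.
- rewrite cardsU1 cS; case uSE: (u \in S) => //.
  by have [_] := uS _ uSE; rewrite rr.
- move=> v w /setU1P[->|vS] /setU1P[->|wS]; rewrite ?eqxx // => vw.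
  + by case: (uS _ wS).
  + have [vB vu] := uS _ vS; apply: contra vu; exact: sym.
  + exact: indS.
Qed.

Definition star (V : finType) (H : {set {set V}}) (v : V) : {set {set V}} :=
  [set e in H | v \in e].

(** The clique created by adding [S] must use [S], since [H] has none; [u] and [v] form the pair
    that [S] represents, and injectivity keeps all other pairs in [H]. *)
Lemma saturated_core (V : finType) (l k : nat) (H : {set {set V}}) (S : {set V}) :
  2 <= l -> berge_saturated (complete_graph l) k H -> #|S| = k -> S \notin H ->
  exists (K : {set V}) (psi : {set V} -> {set V}) (u v : V),
  [/\ #|K| = l, {in pairs K &, injective psi},
      forall s, s \in pairs K -> s \subset psi s /\
        (s != [set u; v] -> psi s \in H) &
      [/\ u \in K, v \in K, u \in S, v \in S & u != v]].
Proof.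
move=> l2 [_ free sat] cS SH.
have /(berge_cliqueP _ l2)[K [psi [cK inj h]]] := sat S cS SH.
have [s [sK sS]] : exists s, s \in pairs K /\ psi s = S.
  apply: contrapT => no; apply: free; apply/(berge_cliqueP _ l2).
  exists K, psi; split=> // s sK; have [/setU1P[E|//] ?] := h s sK.
  by case: no; exists s.
have /pairsP[u [v [uK vK uv sE]]] := sK.
exists K, psi, u, v; split=> //.
- move=> t tK; have [th ts] := h t tK; split=> // tuv.
  case/setU1P: th => // E; case/eqP: tuv; rewrite -sE.
  by apply: inj => //; rewrite E sS.
- have [_ /subsetP sub] := h s sK; rewrite sS in sub.
  by split=> //; apply: sub; rewrite sE ?set21 ?set22.
Qed.

Definition large (V : finType) (H : {set {set V}}) (D : nat) : {set V} :=
  [set v | D < #|star H v|].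

Definition large_star (V : finType) (H : {set {set V}}) (D : nat) (v : V) :
    {set {set V}} :=
  [set e in star H v | e :&: large H D != set0].

(** The exceptional vertices of the lower bound. For fixed [D] their number turns out to be bounded
    independently of [#|V|]. *)
Definition poor (V : finType) (H : {set {set V}}) (D l : nat) : {set V} :=
  [set v | (v \notin large H D) && (#|large_star H D v| < l - 2)].

(** With more poor vertices, [k] pairwise distant ones could be chosen greedily. Saturation at the
    set they form yields one that lies on [l - 2] edges meeting the large vertices, so is not
    poor. *)
Lemma card_poor (V : finType) (l k D : nat) (H : {set {set V}}) :
  3 <= l -> 2 <= k -> berge_saturated (complete_graph l) k H ->
  #|poor H D l| <= k * (D * k * (D * k)).+1.
Proof.
move=> l3 k2 satH; rewrite leqNgt; apply/negP => big.
pose nb v := cover (star H v).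
have nbP v w :
    reflect (exists2 e, e \in H & (v \in e) && (w \in e)) (w \in nb v).
  apply: (iffP bigcupP) => [[e]|[e eH /andP[ve we]]].
    by rewrite inE => /andP[eH ve] we; exists e; rewrite ?ve.
  by exists e; rewrite ?inE ?eH.
have nbC v w : w \in nb v -> v \in nb w.
  by move/nbP => [e eH /andP[ve we]]; apply/nbP; exists e; rewrite ?ve ?we.
have cnb v : v \notin large H D -> #|nb v| <= D * k.
  rewrite inE -leqNgt => dv; apply: leq_trans (_ : #|star H v| * k <= _).
    apply: leq_card_bigcup_const => e; rewrite inE => /andP[eH _].
    by case: satH => /(_ e eH)->.
  by rewrite leq_mul2r dv orbT.
(* The vertices reached from [u] in two steps with a middle vertex that is not large: at most $1 +
   (Dk)^2$ of them if [u] is not large. The middle vertex may be [u] itself, so neighbours are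
   included. *)
pose r u := u |: \bigcup_(w in nb u :\: large H D) nb w.
have rP u v : reflect
    (v = u \/ exists2 w, w \notin large H D & (w \in nb u) && (v \in nb w))
    (v \in r u).
  apply: (iffP setU1P) => -[->|]; [by left| |by left|].
    by move/bigcupP => [w /setDP[wu wL] vw]; right; exists w; rewrite ?wu.
  move=> [w wL /andP[wu vw]]; right; apply/bigcupP.
  by exists w; rewrite // in_setD wL.
have [S [SB cS indS]] : exists S : {set V}, [/\ S \subset poor H D l, #|S| = k &
    forall u v, u \in S -> v \in S -> u != v -> v \notin r u].
  apply: independent_subset (ltnW big) => //.
  - move=> u; rewrite inE => /andP[uL _].
    rewrite cardsU1 -add1n leq_add ?leq_b1 //.
    apply: leq_trans (leq_card_bigcup_const _) _.
      by move=> w /setDP[_ /cnb]; exact.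
    rewrite leq_mul2r (leq_trans _ (cnb u uL)) ?orbT //.
    by rewrite subset_leq_card ?subsetDl.
  - by move=> u; rewrite setU11.
  - move=> u v _ _ /rP[->|[w wL /andP[wu vw]]]; apply/rP; [by left|right].
    by exists w => //; rewrite (nbC _ _ wu) (nbC _ _ vw).
have smallS u : u \in S -> u \notin large H D.
  by move/(subsetP SB); rewrite inE => /andP[].
have SH : S \notin H.
  apply/negP => SH.
  have [u [v [uS vS uv]]] : exists u v, [/\ u \in S, v \in S & u != v].
    have /card_gt1P[u [v [? ? ?]]] : 1 < #|S| by rewrite cS.
    by exists u, v.
  have /negP[] := indS u v uS vS uv; apply/rP; right; exists u; first exact: smallS.
  by apply/andP; split; apply/nbP; exists S; rewrite ?uS.
have [K [psi [u [v [cK inj h [uK vK uS vS uv]]]]]] :=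
  saturated_core (ltnW l3) satH cS SH.
have edge x y w :
    [set x; y] = [set u; v] -> x \in K -> w \in K :\: [set u; v] ->
    psi [set x; w] \in H /\ (x \in psi [set x; w]) && (w \in psi [set x; w]).
  move=> E xK /setDP[wK]; rewrite -E !inE negb_or => /andP[wx wy].
  have xwK : [set x; w] \in pairs K by apply: mem_pairs; rewrite // eq_sym.
  have [sub out] := h _ xwK; split.
    apply: out; rewrite -E; apply/eqP => /set2_eq[[_ F]|[_ F]].
      by rewrite F eqxx in wy.
    by rewrite F eqxx in wx.
  by rewrite !(subsetP sub) ?set21 ?set22.
(* A core vertex [w] that is not large would be a common neighbour of [u] and [v] and put [v] into
   [r u]. *)
have wL w : w \in K :\: [set u; v] -> w \in large H D.
  move=> wK; apply: contraT => wL; have /negP[] := indS u v uS vS uv.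
  apply/rP; right; exists w => //.
  have [e1 e1P] := edge u v w erefl uK wK.
  have [e2 e2P] := edge v u w (setUC _ _) vK wK.
  apply/andP; split; apply/nbP; first by exists (psi [set u; w]).
  by exists (psi [set v; w]) => //; rewrite andbC.
have := subsetP SB _ uS; rewrite inE smallS //= ltnNge => /negP[].
(* The representatives of the pairs [[set u; w]] are the [l - 2] distinct edges that contradict
   poverty of [u]. *)
have <- : #|[set psi [set u; w] | w in K :\: [set u; v]]| = l - 2.
  rewrite card_in_imset.
    by rewrite cardsDS ?cK ?cards2 ?uv // subUset !sub1set uK.
  have pK w : w \in K :\: [set u; v] -> [set u; w] \in pairs K.
    move=> /setDP[wK]; rewrite in_set2 negb_or => /andP[wu _].
    by apply: mem_pairs; rewrite // eq_sym.
  move=> w w' wK wK' /(inj _ _ (pK _ wK) (pK _ wK'))/set2_eq[[]//|[E _]].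
  by move: wK'; rewrite -E !inE eqxx.
apply: subset_leq_card; apply/subsetP => e /imsetP[w wK ->].
have [eH /andP[ue we]] := edge u v w erefl uK wK.
rewrite !inE eH ue; apply/set0Pn; exists w; rewrite inE we; exact: wL.
Qed.

Lemma sum_star (V : finType) (H : {set {set V}}) (A : {set V}) :
  \sum_(v in A) #|star H v| = \sum_(e in H) #|e :&: A|.
Proof.
under eq_bigr do rewrite -sum1_card.
under [RHS]eq_bigr do rewrite -sum1_card.
rewrite (exchange_big_dep (mem H)) /=; last first.
  by move=> v e _; rewrite inE => /andP[].
apply: eq_bigr => e eH; apply: eq_bigl => v; by rewrite !inE eH andbC.
Qed.

(** [D] stays free: after division by [D.+1], the middle term is a small multiple of [#|H|] for
    large [D], and the last one does not depend on [#|V|]. *)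
Lemma saturated_lower_bound (V : finType) (l k D : nat) (H : {set {set V}}) :
  3 <= l -> 2 <= k -> berge_saturated (complete_graph l) k H ->
  D.+1 * (l - 2) * #|V| <= D.+1 * (k - 1) * #|H| + (l - 2) * k * #|H| +
    D.+1 * (l - 2) * (k * (D * k * (D * k)).+1).
Proof.
move=> l3 k2 satH; have cP := @card_poor V l k D H l3 k2 satH.
have [unif _ _] := satH.
have hL : D.+1 * #|large H D| <= k * #|H|.
  rewrite mulnC -sum_nat_const.
  apply: (@leq_trans (\sum_(v in large H D) #|star H v|)).
    by apply: leq_sum => v; rewrite inE.
  rewrite sum_star mulnC -sum_nat_const; apply: leq_sum => e eH.
  by rewrite -(unif e eH) subset_leq_card ?subsetIl.
pose good := ~: (large H D :|: poor H D l).
have cV : #|V| <= #|good| + #|large H D| + #|poor H D l|.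
  rewrite -(cardsC (large H D :|: poor H D l)) -/good.
  have le : #|_| <= _ := leq_card_setU (large H D) (poor H D l).
  by rewrite addnC -addnA leq_add2l.
(* Double counting of pairs of a good vertex and an edge of [H']: each good vertex lies on [l - 2]
   such edges, and each such edge loses a vertex to the large set. *)
have hG : (l - 2) * #|good| <= (k - 1) * #|H|.
  pose H' := [set e in H | e :&: large H D != set0].
  apply: (@leq_trans (\sum_(v in good) #|star H' v|)).
    rewrite mulnC -sum_nat_const; apply: leq_sum => v.
    rewrite /good in_setC in_setU negb_or => /andP[vL].
    rewrite [v \in poor _ _ _]inE vL /= -leqNgt => le.
    apply: leq_trans le _; apply: subset_leq_card; apply/subsetP => e.
    by rewrite !inE andbAC.
  rewrite sum_star; apply: (@leq_trans (\sum_(e in H') (k - 1))).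
    apply: leq_sum => e; rewrite inE => /andP[eH /set0Pn[w]].
    rewrite in_setI => /andP[we wL]; rewrite -(unif e eH) (cardsD1 w e) we add1n subn1.
    apply: subset_leq_card; apply/subsetP => x.
    rewrite in_setI in_setC in_setU negb_or => /andP[xe /andP[xL _]].
    by rewrite in_setD1 xe andbT; apply: contraNneq xL => ->.
  rewrite sum_nat_const mulnC leq_mul2l; apply/orP; right.
  by apply: subset_leq_card; apply/subsetP => e; rewrite inE => /andP[].
move: hL hG cV cP; move: #|large H D| #|good| #|poor H D l| #|H| (k * _.+1)
  => a g p h M.
move: (l - 2) (k - 1) => x y hL hG cV cP.
have h1 : D.+1 * x * #|V| <= D.+1 * x * (g + a + p) by rewrite leq_mul2l cV orbT.
have h2 : D.+1 * (x * g) <= D.+1 * (y * h) by rewrite leq_mul2l hG orbT.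
have h3 : x * (D.+1 * a) <= x * (k * h) by rewrite leq_mul2l hL orbT.
have h4 : D.+1 * x * p <= D.+1 * x * M by rewrite leq_mul2l cP orbT.
apply: leq_trans h1 _; nia.
Qed.

(** * The upper bound *)

Lemma berge_cliqueS (V : finType) (l : nat) (H H' : {set {set V}}) :
  H \subset H' -> berge_clique l H -> berge_clique l H'.
Proof.
move=> /subsetP sub [K [psi [cK inj h]]]; exists K, psi; split=> // s /h[? ?].
by split=> //; exact: sub.
Qed.

(** As [e] is new, no other pair uses it, so it can represent the one open pair [t] without harming
    injectivity. *)
Lemma berge_clique_add (V : finType) (l : nat) (H : {set {set V}})
    (e t : {set V}) (K : {set V}) (psi : {set V} -> {set V}) :
  e \notin H -> t \subset e -> #|K| = l ->
  {in pairs K :\ t &, injective psi} ->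
  (forall s, s \in pairs K :\ t -> psi s \in H /\ s \subset psi s) ->
  berge_clique l (e |: H).
Proof.
move=> eH te cK inj h; exists K, (fun s => if s == t then e else psi s).
split=> //.
- move=> s s' sK sK'; case: (eqVneq s t) => [->|st];
    case: (eqVneq s' t) => [->//|st'] E.
  + have [] := h s' _; first by rewrite in_setD1 st'.
    by rewrite -E (negbTE eH).
  + have [] := h s _; first by rewrite in_setD1 st.
    by rewrite E (negbTE eH).
  + by apply: inj; rewrite // in_setD1 ?st ?st'.
- move=> s sK; case: (eqVneq s t) => [->|st]; first by rewrite setU11.
  have [|? ?] := h s; first by rewrite in_setD1 st.
  by rewrite setU1r.
Qed.

(** * The design: a free hypergraph in which most further edges create a clique *)

Definition hub_edges (V : finType) (W : {set V}) (P : {set {set V}}) :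
    {set {set V}} := [set w |: p | w in W, p in P].

Definition pair_edges (V : finType) (W C : {set V}) : {set {set V}} :=
  [set s :|: C | s in pairs W].

(** [C] will be a block with its vertex [b] removed, hence of size [k - 2], so that the pair edges
    have size [k]. *)
Definition design (V : finType) (W : {set V}) (P : {set {set V}}) (C : {set V}) :
    {set {set V}} := hub_edges W P :|: pair_edges W C.

(** A partition of the complement of [W], except that several blocks may share [b]. *)
Record blocks (V : finType) (k : nat) (W : {set V}) (b : V)
    (P : {set {set V}}) : Prop := Blocks {
  card_block : forall p, p \in P -> #|p| = k.-1 ;
  block_out : forall p x, p \in P -> x \in p -> x \notin W ;
  block_inter : forall p q x, p \in P -> q \in P -> x \in p -> x \in q ->
    x != b -> p = q ;
  block_cover : forall x, x \notin W -> exists2 p, p \in P & x \in p }.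

Lemma leq_card_design (V : finType) (W : {set V}) (P : {set {set V}}) (C : {set V}) :
  #|design W P C| <= #|W| * #|P| + 'C(#|W|, 2).
Proof.
apply: leq_trans (leq_card_setU _ _) _; apply: leq_add.
  by rewrite -cardsX /hub_edges curry_imset2X leq_imset_card.
by rewrite -card_pairs leq_imset_card.
Qed.

Lemma uniform_design (V : finType) (k : nat) (W : {set V}) (b : V)
    (P : {set {set V}}) (G : {set V}) :
  3 <= k -> blocks k W b P -> G \in P -> b \in G ->
  uniform k (design W P (G :\ b)).
Proof.
move=> k3 bl GP bG e /setUP[/imset2P[w p wW pP ->]|/imsetP[s sW ->]].
  rewrite cardsU1 (card_block bl pP); case wp: (w \in p); last by lia.
  by have := block_out bl pP wp; rewrite wW.
have := cardsD1 b G; rewrite bG (card_block bl GP) => cG.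
have /setP dis : s :&: (G :\ b) =i set0.
  move=> x; rewrite !inE; apply/negP => /andP[xs /andP[_ xG]].
  move: sW; rewrite inE => /andP[/subsetP/(_ x xs) xW _].
  by have := block_out bl GP xG; rewrite xW.
by rewrite cardsU dis cards0; move: sW; rewrite inE => /andP[_ /eqP ->]; lia.
Qed.

(* A vertex outside W and G has degree at most l - 2, so the core K lies in
   W U G.  Pick y in K and G - b, and z <> y in K such that K - z avoids b.  Only
   the edges w + G and {w, w'} + (G - b) can represent the pairs of K - z and the
   pair {y, z}, and they are one too few. *)
Lemma design_free (V : finType) (l k : nat) (W : {set V}) (b : V)
    (P : {set {set V}}) (G : {set V}) :
  3 <= l -> #|W| = l - 2 -> blocks k W b P -> G \in P -> b \in G ->
  ~ berge_clique l (design W P (G :\ b)).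
Proof.
move=> l3 cW bl GP bG [K [psi [cK inj h]]].
have KS x : x \in K -> x \in W :|: G.
  move=> xK; apply: contraT; rewrite inE negb_or => /andP[xW xG].
  have : l.-1 <= #|star (design W P (G :\ b)) x|.
    rewrite -cK (cardsD1 x K) xK add1n /= -(@card_in_imset _ _ (fun y => psi [set x; y])).
      apply: subset_leq_card; apply/subsetP => e /imsetP[y /setD1P[yx yK] ->].
      have [] := h [set x; y] _; first by rewrite mem_pairs // eq_sym.
      by move=> pH /subsetP sub; rewrite [_ \in star _ _]inE pH sub ?set21.
    move=> y y' /setD1P[yx yK] /setD1P[yx' yK'] /inj.
    rewrite !mem_pairs 1?eq_sym // => /(_ isT isT)/set2_eq[[]//|[E _]].
    by rewrite E eqxx in yx'.
  have starP e : e \in star (design W P (G :\ b)) x ->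
      exists w p, [/\ w \in W, p \in P, e = w |: p & x \in p].
    rewrite [_ \in star _ _]inE.
    move=> /andP[/setUP[/imset2P[w p wW pP ->]|/imsetP[s sW ->]]].
      case/setU1P => [xw|xp]; first by rewrite xw wW in xW.
      by exists w, p.
    case/setUP => [xs|/setD1P[_ xG']]; last by rewrite xG' in xG.
    by move: sW xW; rewrite inE => /andP[/subsetP/(_ x xs) ->].
  have [->|[e0 /starP[_ [p [_ pP _ xp]]]]] :=
    set_0Vmem (star (design W P (G :\ b)) x).
    by rewrite cards0; lia.
  have xb : x != b by apply: contraNneq xG => ->.
  rewrite leqNgt => /negP[]; apply: (@leq_ltn_trans (l - 2)); last by lia.
  rewrite -cW; apply: leq_trans (leq_imset_card (fun w => w |: p) W).
  apply: subset_leq_card; apply/subsetP => e /starP[w [q [wW qP -> xq]]].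
  by apply/imsetP; exists w; rewrite // (block_inter bl qP pP xq xp xb).
have [y yK /setD1P[yb yG]] : exists2 y, y \in K & y \in G :\ b.
  have /subsetPn[y yK] : ~~ (K \subset b |: W).
    apply/negP => /subset_leq_card; rewrite cK cardsU1 cW; case: (b \notin W); lia.
  rewrite !inE negb_or => /andP[yb yW]; exists y => //.
  by have := KS y yK; rewrite !inE yb (negbTE yW).
have [z [zK zy zb]] :
    exists z, [/\ z \in K, z != y & forall x, x \in K -> x != z -> x != b].
  case bK: (b \in K); first by exists b; rewrite bK eq_sym.
  have /card_gt0P[z /setD1P[zy zK]] : 0 < #|K :\ y|.
    by have := cardsD1 y K; rewrite yK cK; lia.
  by exists z; split=> // x xK _; apply: contraTneq xK => ->; rewrite bK.
pose Q := [set y; z] |: pairs (K :\ z).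
have cQ : #|Q| = 'C(l.-1, 2).+1.
  rewrite cardsU1 card_pairs.
  have -> : #|K :\ z| = l.-1 by have := cardsD1 z K; rewrite zK cK; lia.
  by rewrite inE subUset !sub1set !inE eqxx /= andbF.
have QK s : s \in Q -> s \in pairs K.
  case/setU1P => [->|]; first by rewrite mem_pairs // eq_sym.
  by rewrite !inE => /andP[/subset_trans -> //]; rewrite subsetDl.
have : #|psi @: Q| <= 'C(l - 2, 2) + (l - 2).
  apply: (@leq_trans #|pair_edges W (G :\ b) :|: [set w |: G | w in W]|); last first.
    apply: leq_trans (leq_card_setU _ _) _; rewrite -cW leq_add ?leq_imset_card //.
    by rewrite -card_pairs leq_imset_card.
  apply: subset_leq_card; apply/subsetP => e /imsetP[s sQ ->].
  have [] := h s (QK s sQ); rewrite inE => /orP[|eP _]; last by rewrite inE eP.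
  move=> /imset2P[w p wW pP ->] sub; rewrite inE; apply/orP; right.
  (* Such an [x] lies in [p], hence in [G], and is not [b]. As blocks share only [b], this forces
     [p] to be [G]. *)
  suff [x [xs xw xG xb]] :
      exists x, [/\ x \in s, x != w, x \in W -> x == w & x != b].
    have xp : x \in p.
      by have := subsetP sub x xs; rewrite !inE (negbTE xw).
    have xK : x \in K.
      by have := QK s sQ; rewrite inE => /andP[/subsetP/(_ x xs)].
    have xG' : x \in G.
      by have := KS x xK; rewrite in_setU (negbTE (block_out bl pP xp)).
    by apply/imsetP; exists w; rewrite // (block_inter bl pP GP xp xG' xb).
  have nW x : x \in s -> x != w -> x \in W -> x == w.
    move=> xs xw xW; have := subsetP sub x xs; rewrite !inE (negbTE xw) /= => xp.
    by have := block_out bl pP xp; rewrite xW.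
  case/setU1P: (sQ) => [E|].
    have yw : y != w by apply: contraTneq wW => <-; exact: (block_out bl GP).
    by exists y; split=> //; rewrite ?E ?set21 //; apply: nW; rewrite ?E ?set21.
  move=> /pairsP[x1 [x2 [/setD1P[x1z x1K] /setD1P[x2z x2K] x12 E]]].
  case: (eqVneq x1 w) => [x1w|x1w]; [exists x2|exists x1]; split=> //.
  + by rewrite E set22.
  + by rewrite -x1w eq_sym.
  + by apply: nW; rewrite ?E ?set22 // -x1w eq_sym.
  + exact: zb.
  + by rewrite E set21.
  + by apply: nW; rewrite ?E ?set21.
  + exact: zb.
rewrite card_in_imset => [|s t /QK sK /QK tK]; last exact: inj.
rewrite cQ (_ : l.-1 = (l - 2).+1); last by lia.
by rewrite binS bin1 ltnn.
Qed.

(* The edge representing the pair s of W U {x, y}, for x in the block p and y in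
   the block q; C is G - b. *)
Definition design_edge (V : finType) (W : {set V}) (x y : V) (p q C s : {set V}) :
    {set V} :=
  (s :&: W) :|: (if x \in s then p else if y \in s then q else C).

Lemma pairs_setU2P (V : finType) (W : {set V}) (x y : V) (s : {set V}) :
  x \notin W -> y \notin W -> x != y ->
  s \in pairs (x |: (y |: W)) :\ [set x; y] ->
  [\/ exists2 w, w \in W & s = [set w; x], exists2 w, w \in W & s = [set w; y]
    | s \in pairs W].
Proof.
move=> xW yW xy /setD1P[sxy /pairsP[u [v [uK vK uv E]]]]; move: uK vK uv sxy.
rewrite {s}E => /setU1P[->|/setU1P[->|uW]] /setU1P[->|/setU1P[->|vW]];
  rewrite ?eqxx // => uv.
- by constructor 1; exists v => //; rewrite setUC.
- by rewrite setUC eqxx.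
- by constructor 2; exists v => //; rewrite setUC.
- by constructor 1; exists u.
- by constructor 2; exists u.
- by constructor 3; exact: mem_pairs.
Qed.

(** The design already represents every pair of [K] but [[set x; y]]. Injectivity: [psi s] has the
    trace of [s] on [W], and outside [W] it is [p], [q] or [G :\ b]. These differ, the last being
    too small for a block, and so tell which of [x] and [y] is in [s]. *)
Lemma design_edgeP (V : finType) (k : nat) (W : {set V}) (b x y : V)
    (P : {set {set V}}) (G p q : {set V}) :
  3 <= k -> blocks k W b P -> G \in P -> b \in G -> x != y ->
  p \in P -> x \in p -> q \in P -> y \in q -> p != q ->
  let K := x |: (y |: W) in
  let psi := design_edge W x y p q (G :\ b) in
  {in pairs K :\ [set x; y] &, injective psi} /\
  forall s, s \in pairs K :\ [set x; y] ->
    psi s \in design W P (G :\ b) /\ s \subset psi s.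
Proof.
move=> k3 bl GP bG xy pP xp qP yq pq K psi.
have xW := block_out bl pP xp; have yW := block_out bl qP yq.
have CP r : r \in P -> G :\ b != r.
  move=> rP; apply: contraTneq k3 => E.
  by have := cardsD1 b G; rewrite E bG !(card_block bl) // -ltnNge; lia.
have dis s : psi s :&: W = s :&: W /\
    psi s :\: W = if x \in s then p else if y \in s then q else G :\ b.
  set D := (if _ then _ else _); have DW z : z \in D -> z \notin W.
    rewrite /D; case: ifP => _; first exact: (block_out bl pP).
    case: ifP => _; first exact: (block_out bl qP).
    by move=> /setD1P[_]; exact: (block_out bl GP).
  split; apply/setP => z; rewrite /psi /design_edge -/D !inE; have := DW z;
    by case: (z \in D); case: (z \in W); case: (z \in s) => // /(_ isT).
split.
- move=> s t sK tK E.
  have [I D] : s :&: W = t :&: W /\ (x \in s) = (x \in t) /\ (y \in s) = (y \in t).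
    have [<- sD] := dis s; have [<- tD] := dis t; rewrite E in sD *; split=> //.
    have nxy r : r \in pairs K :\ [set x; y] -> x \in r -> y \in r -> False.
      move=> /(pairs_setU2P xW yW xy)[[w wW ->]|[w wW ->]|].
      + by move=> _ /set2P[E'|E']; [rewrite -E' (negbTE yW) in wW|rewrite E' eqxx in xy].
      + by move=> /set2P[E'|E']; [rewrite -E' (negbTE xW) in wW|rewrite E' eqxx in xy].
      + by rewrite inE => /andP[/subsetP/(_ x) h _] /h; rewrite (negbTE xW).
    have := CP p pP; have := CP q qP; move: pq (nxy s sK) (nxy t tK).
    rewrite sD in tD; move: tD.
    case: (x \in s); case: (x \in t); case: (y \in s); case: (y \in t) => // E';
      rewrite ?E' ?eqxx //=;
      move=> _ h1 h2; try (by case: (h1 isT isT)); case: (h2 isT isT).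
  have sub r : r \in pairs K :\ [set x; y] -> r \subset K.
    by move=> /setD1P[_]; rewrite inE => /andP[].
  have [Dx Dy] := D; apply/setP => z.
  case zK: (z \in K); last first.
    apply/idP/idP => h; first by rewrite (subsetP (sub s sK) z h) in zK.
    by rewrite (subsetP (sub t tK) z h) in zK.
  case/setU1P: zK => [->//|/setU1P[->//|zW]].
  by have /setP/(_ z) := I; rewrite !inE zW !andbT.
- move=> s /(pairs_setU2P xW yW xy) sE.
  have wx w : w \in W -> (x == w) = false by move=> wW; apply: contraNF xW => /eqP->.
  have wy w : w \in W -> (y == w) = false by move=> wW; apply: contraNF yW => /eqP->.
  have hub z r w : z \notin W -> w \in W -> r \in P -> z \in r ->
      [set w; z] :&: W :|: r \in design W P (G :\ b) /\
      [set w; z] \subset [set w; z] :&: W :|: r.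
    move=> zW wW rP zr; have -> : [set w; z] :&: W = [set w].
      apply/setP => t; rewrite !inE; case: eqVneq => [->|_]; rewrite ?wW //=.
      by case: eqVneq => [->|//]; rewrite (negbTE zW).
    split; last by rewrite subUset !sub1set !inE eqxx zr orbT.
    by rewrite inE; apply/orP; left; apply/imset2P; exists w r.
  case: sE => [[w wW ->]|[w wW ->]|sW]; rewrite /psi /design_edge.
  + by rewrite set22; exact: hub.
  + by rewrite set22 !in_set2 wx // (negbTE xy); exact: hub.
  + have sub : s \subset W by move: sW; rewrite inE => /andP[].
    rewrite !(contraNF (subsetP sub _)) //.
    rewrite (setIidPl sub) subsetUl; split=> //.
    by rewrite inE; apply/orP; right; apply/imsetP; exists s.
Qed.

(** If [e] leaves the block [p] of [u] and [W], it joins two blocks and represents the missing pair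
    directly. Otherwise it has two vertices in [W], and a chain of reassigned edges is needed. *)
Lemma design_saturating (V : finType) (l k : nat) (W : {set V}) (b : V)
    (P : {set {set V}}) (G G' e p : {set V}) (u : V) :
  3 <= l -> 3 <= k -> #|W| = l - 2 -> blocks k W b P ->
  G \in P -> b \in G -> G' \in P -> b \in G' -> G != G' ->
  #|e| = k -> e \notin design W P (G :\ b) ->
  u \in e -> p \in P -> u \in p -> b \notin p ->
  berge_clique l (e |: design W P (G :\ b)).
Proof.
move=> l3 k3 cW bl GP bG GP' bG' GG ce eH ue pP up bp.
have uW := block_out bl pP up.
have cK x y : x \notin W -> y \notin W -> x != y -> #|x |: (y |: W)| = l.
  by move=> xW yW xy; rewrite !cardsU1 !inE negb_or xy xW yW cW; exact: (subnKC (ltnW l3)).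
have [/subsetP sub|/subsetPn[x xe]] := boolP (e \subset p :|: W); last first.
  rewrite inE negb_or => /andP[xp xW].
  have [q qP xq] := block_cover bl xW.
  have pq : p != q by apply: contraNneq xp => ->.
  have ux : u != x by apply: contraNneq xp => <-.
  have [inj h] := design_edgeP k3 bl GP bG ux pP up qP xq pq.
  apply: (berge_clique_add eH _ (cK _ _ uW xW ux) inj h).
  by rewrite subUset !sub1set ue xe.
have eE : e = (e :&: p) :|: (e :&: W) by rewrite -setIUr; apply/esym/setIidPl/subsetP.
have lep : #|e :&: p| <= k.-1 by rewrite -(card_block bl pP) subset_leq_card ?subsetIr.
(* With at most one vertex in [W], the edge would by its size be [w |: p], which is in the
   design. *)
have : 1 < #|e :&: W|.
  rewrite ltnNge; apply: contra eH => le1.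
  have := leq_card_setU (e :&: p) (e :&: W) => -[]; rewrite -eE ce => le _.
  have /eqP/cards1P[w wE] : #|e :&: W| = 1 by lia.
  have wW : w \in W by have := set11 w; rewrite -wE inE => /andP[].
  rewrite inE; apply/orP; left; apply/imset2P; exists w p => //.
  apply/eqP; rewrite eqEcard ce cardsU1 (card_block bl pP).
  have -> : w \notin p by apply: contraTN wW => /(block_out bl pP).
  rewrite (_ : _ + _ <= k) ?andbT; last by lia.
  by rewrite eE wE setUC setUS ?subsetIr.
case/card_gt1P => wi [wj [/setIP[ie iW] /setIP[je jW] ij]].
(* The core is now [W] with [a] and [b], taking [G] as the block of [a] and [G'] as that of [b]; the
   open pair is [[set a; b]]. *)
have [a /setD1P[ab aG]] : exists a, a \in G :\ b.
  apply/set0Pn; rewrite -card_gt0 -ltnS.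
  have <- : #|G| = #|G :\ b|.+1 by rewrite (cardsD1 b G) bG.
  by rewrite (card_block bl GP) -ltnS (ltn_predK k3).
have aW := block_out bl GP aG; have bW := block_out bl GP bG.
have [inj h] := design_edgeP k3 bl GP bG ab GP aG GP' bG' GG.
set psi := design_edge _ _ _ _ _ _ in inj h; set K := a |: (b |: W) in inj h.
have [aK bK] : a \in K /\ b \in K by rewrite !inE !eqxx orbT.
have WK w : w \in W -> w \in K by rewrite !inE => ->; rewrite !orbT.
have nW w x : w \in W -> x \notin W -> w != x by move=> wW; apply: contraNneq => <-.
pose s0 := [set a; b]; pose s1 := [set wi; a]; pose s2 := [set wi; wj].
have [p0 p1 p2] : [/\ s0 \in pairs K, s1 \in pairs K & s2 \in pairs K].
  by split; apply: mem_pairs => //; auto.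
have s01 : s1 != s0.
  by apply/eqP => /setP/(_ wi); rewrite set21 !inE !(negbTE (nW _ _ _ _)).
have s02 : s2 != s0.
  by apply/eqP => /setP/(_ wi); rewrite set21 !inE !(negbTE (nW _ _ _ _)).
have s12 : s2 != s1.
  by apply/eqP => /setP/(_ wj); rewrite set22 !inE eq_sym (negbTE ij) (negbTE (nW _ _ _ _)).
(* The new edge represents s2, which frees the edge of s2 for s1, and that of
   s1 for s0. *)
pose rho s := if s == s0 then s1 else if s == s1 then s2 else s.
have rhoK s : s \in pairs K :\ s2 -> rho s \in pairs K :\ s0.
  move=> /setD1P[ss2 sK]; rewrite in_setD1 /rho.
  case: (eqVneq s s0) => [_|ss0]; first by rewrite s01.
  by case: (eqVneq s s1) => [_|ss1]; rewrite ?s02 ?ss0.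
apply: (@berge_clique_add V l _ e s2 K (psi \o rho)) => //.
- by rewrite subUset !sub1set ie je.
- exact: cK.
- move=> s t sK tK /(inj _ _ (rhoK s sK) (rhoK t tK)).
  move: sK tK => /setD1P[ss2 _] /setD1P[ts2 _]; rewrite /rho.
  case: (eqVneq s s0) => [->|ss0]; case: (eqVneq t s0) => [->|ts0] //.
  + by case: (eqVneq t s1) => [_ E|ts1 E]; [rewrite E eqxx in s12|rewrite E eqxx in ts1].
  + by case: (eqVneq s s1) => [_ E|ss1 E]; [rewrite E eqxx in s12|rewrite E eqxx in ss1].
  + case: (eqVneq s s1) => [->|ss1]; case: (eqVneq t s1) => [->|ts1] // E.
      by rewrite E eqxx in ts2.
    by rewrite E eqxx in ss2.
- move=> s sK /=; have [-> sub'] := h _ (rhoK s sK); split=> //.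
  move: sub'; rewrite /rho; case: (eqVneq s s0) => [->|_].
    move=> _; rewrite /psi /design_edge set22 subUset !sub1set.
    by rewrite !(in_setU, aG, bG) !orbT.
  case: (eqVneq s s1) => [->|//] _.
  rewrite /psi /design_edge !in_set2 ![_ == wi]eq_sym ![_ == wj]eq_sym.
  rewrite !(negbTE (nW _ _ _ _)) //= subUset !sub1set.
  by rewrite !(in_setU, in_setI, in_setD1, in_set1) eqxx iW aG ab orbT.
Qed.

(** * Existence of the blocks and size of a saturated extension *)

Lemma subset_of_card (V : finType) (A : {set V}) q : q <= #|A| ->
  exists2 B : {set V}, B \subset A & #|B| = q.
Proof.
rewrite -bin_gt0 -cards_draws => /card_gt0P[B]; rewrite inE => /andP[BA /eqP cB].
by exists B.
Qed.

Lemma equipartition (V : finType) (q m : nat) (A : {set V}) :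
  0 < q -> #|A| = m * q ->
  exists P : {set {set V}}, [/\ #|P| = m, trivIset P, cover P = A &
    forall p, p \in P -> #|p| = q].
Proof.
move=> q0; elim: m A => [|m IH] A cA.
  exists set0; split; rewrite ?cards0 //; last by move=> p; rewrite inE.
    by apply/trivIsetP => p p'; rewrite inE.
  by rewrite /cover big_set0; apply/esym/eqP; rewrite -cards_eq0 cA.
have [B BA cB] : exists2 B : {set V}, B \subset A & #|B| = q.
  by apply: subset_of_card; rewrite cA mulSn leq_addr.
have [|P [cP tP covP Pq]] := IH (A :\: B).
  by rewrite cardsDS // cA cB mulSn addKn.
have dis p : p \in P -> [disjoint B & p].
  move=> pP; rewrite disjoint_sym disjoints_subset; apply/subsetP => x xp.
  have : x \in cover P by apply/bigcupP; exists p.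
  by rewrite covP !inE => /andP[].
have BP : B \notin P.
  by apply/negP => /dis; rewrite -setI_eq0 setIid -cards_eq0 cB -leqn0 leqNgt q0.
exists (B |: P); split.
- by rewrite cardsU1 BP cP.
- apply/trivIsetP => p p' /setU1P[->|pP] /setU1P[->|pP']; rewrite ?eqxx // => pp.
  + exact: dis.
  + by rewrite disjoint_sym dis.
  + by move/trivIsetP: tP; apply.
- rewrite /cover bigcup_setU big_set1 -/(cover P) covP setDE setUIr setUCr setIT.
  exact/setUidPr.
- by move=> p /setU1P[->|/Pq].
Qed.

(** Of the vertices outside [W] and other than [b], [r] groups of size [k - 2] are completed by [b],
    and [m] groups of size [k - 1] are blocks by themselves. [2 <= r] provides [G] and [G']. *)
Lemma blocks_exist (V : finType) (w k m r : nat) :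
  3 <= k -> 2 <= r -> #|V| = w + 1 + r * (k - 2) + m * (k - 1) ->
  exists (W : {set V}) (b : V) (P : {set {set V}}) (G G' : {set V}),
    [/\ #|W| = w, blocks k W b P, #|P| <= m + r & #|star P b| <= r] /\
    [/\ G \in P, b \in G, G' \in P, b \in G' & G != G'].
Proof.
move=> k3 r2; rewrite -cardsT => cV.
have [W _ cW] : exists2 W : {set V}, W \subset setT & #|W| = w.
  by apply: subset_of_card; rewrite cV -!addnA leq_addr.
have cWC : #|~: W| = (r * (k - 2) + m * (k - 1)).+1.
  by move: cV; rewrite cardsT -(cardsC W) cW; lia.
have [b bW] : exists b, b \in ~: W by apply/card_gt0P; rewrite cWC.
have cB : #|~: W :\ b| = r * (k - 2) + m * (k - 1).
  by move: cWC; rewrite (cardsD1 b) bW => -[].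
have [A AB cA] : exists2 A : {set V}, A \subset ~: W :\ b & #|A| = r * (k - 2).
  by apply: subset_of_card; rewrite cB leq_addr.
have [|Q [cQ tQ covQ Qk]] := @equipartition V (k - 2) r A _ cA; first by lia.
have [||P [cP tP covP Pk]] := @equipartition V (k - 1) m ((~: W :\ b) :\: A).
- by lia.
- by rewrite cardsDS // cB cA addKn.
have QA q x : q \in Q -> x \in q -> [/\ x \in A, x \notin W & x != b].
  move=> qQ xq; have xA : x \in A by rewrite -covQ; apply/bigcupP; exists q.
  by have := subsetP AB x xA; rewrite !inE => /andP[].
have PA p x : p \in P -> x \in p -> [/\ x \notin A, x \notin W & x != b].
  move=> pP xp; have : x \in cover P by apply/bigcupP; exists p.
  by rewrite covP !inE => /and3P[].
have triv (T : {set {set V}}) p q x :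
    trivIset T -> p \in T -> q \in T -> x \in p -> x \in q -> p = q.
  by move=> tT pT qT xp xq; rewrite -(def_pblock tT pT xp) (def_pblock tT qT xq).
have bQ q : q \in Q -> b \notin q.
  by move=> qQ; apply/negP => /(QA _ _ qQ)[_ _]; rewrite eqxx.
have starb : star (P :|: [set b |: q | q in Q]) b \subset [set b |: q | q in Q].
  apply/subsetP => p; rewrite !inE => /andP[/orP[pP|//] bp].
  by have [_ _] := PA _ _ pP bp; rewrite eqxx.
have [q [q' [qQ qQ' qq]]] : exists q q', [/\ q \in Q, q' \in Q & q != q'].
  have /card_gt1P[q [q' [? ? ?]]] : 1 < #|Q| by rewrite cQ.
  by exists q, q'.
exists W, b, (P :|: [set b |: q | q in Q]), (b |: q), (b |: q').
split; split=> //.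
- split.
  + move=> p /setUP[/Pk ->|/imsetP[s sQ ->]]; first by lia.
    by rewrite cardsU1 bQ // Qk //; lia.
  + move=> p x /setUP[pP /(PA _ _ pP)[]//|/imsetP[s sQ ->]].
    by case/setU1P => [->|/(QA _ _ sQ)[]//]; move: bW; rewrite inE.
  + move=> p p' x /setUP[pP|/imsetP[s sQ ->]] /setUP[pP'|/imsetP[s' sQ' ->]].
    * by move=> xp xp' _; apply: triv tP pP pP' xp xp'.
    * move=> xp /setU1P[->|xs]; first by rewrite eqxx.
      by have [xA _ _] := PA _ _ pP xp; have [] := QA _ _ sQ' xs; rewrite (negbTE xA).
    * move=> /setU1P[->|xs] xp; first by rewrite eqxx.
      by have [xA _ _] := PA _ _ pP' xp; have [] := QA _ _ sQ xs; rewrite (negbTE xA).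
    * move=> /setU1P[->|xs]; first by rewrite eqxx.
      move=> /setU1P[->|xs' _]; first by rewrite eqxx.
      by rewrite (triv _ _ _ _ tQ sQ sQ' xs xs').
  + move=> x xW; case: (eqVneq x b) => [->|xb].
      by exists (b |: q); rewrite ?setU11 // inE imset_f // orbT.
    case xA: (x \in A).
      move: (xA); rewrite -covQ => /bigcupP[s sQ xs].
      by exists (b |: s); rewrite ?setU1r // inE imset_f // orbT.
    have : x \in cover P by rewrite covP !inE xA xb.
    by move=> /bigcupP[p pP xp]; exists p => //; rewrite inE pP.
- apply: leq_trans (leq_card_setU _ _) _; rewrite cP leq_add2l -cQ.
  exact: leq_imset_card.
- apply: leq_trans (subset_leq_card starb) _; rewrite -cQ.
  exact: leq_imset_card.
- by rewrite inE imset_f ?orbT.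
- exact: setU11.
- by rewrite inE imset_f ?orbT.
- exact: setU11.
- apply: contra qq => /eqP E; apply/eqP.
  by rewrite -(setU1K (bQ q qQ)) E setU1K // bQ.
Qed.

(** A largest clique-free uniform hypergraph above the design is saturated. The power of two bounds
    the edges outside the design. *)
Lemma saturated_upper_bound (V : finType) (l k m r : nat) :
  3 <= l -> 3 <= k -> 2 <= r ->
  #|V| = (l - 2) + 1 + r * (k - 2) + m * (k - 1) ->
  exists2 H : {set {set V}}, berge_saturated (complete_graph l) k H &
    #|H| <= (l - 2) * (m + r) + 'C(l - 2, 2) + 2 ^ (l - 2 + r * (k - 1)).
Proof.
move=> l3 k3 r2 cV; have l2 := ltnW l3.
have [W [b [P [G [G' [[cW bl cP sP] [GP bG GP' bG' GG]]]]]]] :=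
  blocks_exist k3 r2 cV.
set H0 := design W P (G :\ b).
pose good (H : {set {set V}}) :=
  `[< uniform k H /\ ~ berge_clique l H >] && (H0 \subset H).
have good0 : good H0.
  apply/andP; split=> //; apply/asboolP; split; first exact: (uniform_design k3 bl GP bG).
  exact: (design_free l3 cW bl GP bG).
have [H /andP[/asboolP[uH nH] H0H] maxH] :=
  arg_maxnP (fun H : {set {set V}} => #|H|) good0.
exists H.
  split=> //; first by move/(berge_cliqueP _ l2).
  move=> e ek eH; apply/(berge_cliqueP _ l2); apply: contrapT => ne.
  have /maxH : good (e |: H).
    apply/andP; split; last by rewrite subsetU // H0H orbT.
    by apply/asboolP; split=> // e' /setU1P[->|/uH].
  by rewrite /= cardsU1 eH add1n ltnn.
pose N := W :|: cover (star P b).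
have cN : #|N| <= l - 2 + r * (k - 1).
  apply: leq_trans (leq_card_setU _ _) _; rewrite cW leq_add2l.
  apply: (@leq_trans (#|star P b| * (k - 1))); last by rewrite leq_mul2r sP orbT.
  apply: leq_card_bigcup_const => p; rewrite inE => /andP[pP _].
  by rewrite (card_block bl pP) subn1.
(* An edge with a vertex outside [N] meets a block avoiding [b]; were it not in the design, it would
   create a clique. *)
have sub : H \subset H0 :|: powerset N.
  apply/subsetP => e eH; rewrite in_setU powersetE.
  have [//|eH0 /=] := boolP (e \in H0); apply/subsetP => u ue.
  apply: contraT => uN; case: nH.
  move: uN; rewrite in_setU negb_or => /andP[uW ub].
  have [p pP up] := block_cover bl uW.
  have bp : b \notin p.
    apply: contra ub => bp; apply/bigcupP; exists p => //; by rewrite inE pP.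
  apply: berge_cliqueS (design_saturating l3 k3 cW bl GP bG GP' bG' GG
    (uH e eH) eH0 ue pP up bp).
  by rewrite subUset sub1set eH.
apply: leq_trans (subset_leq_card sub) _.
apply: leq_trans (leq_card_setU _ _) _; apply: leq_add; last first.
  by rewrite card_powerset leq_exp2l.
apply: leq_trans (leq_card_design _ _ _) _.
by rewrite cW leq_add2r leq_mul2l cP orbT.
Qed.

(** * Bounds on the saturation number *)

Lemma complete_graph_neq0 (l : nat) : 2 <= l -> complete_graph l != set0.
Proof.
move=> l2; apply/set0Pn; exists [set Ordinal l2; Ordinal (ltnW l2)].
by rewrite inE cards2.
Qed.

Lemma berge_sat_ub (l k : nat) : 3 <= l -> 3 <= k ->
  exists N C, forall n, N <= n ->
    (k - 1) * berge_sat k n (complete_graph l) <= (l - 2) * n + C.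
Proof.
move=> l3 k3.
exists (l - 1 + k * k),
  ((k - 1) * ((l - 2) * k + 'C(l - 2, 2) + 2 ^ (l - 2 + k * (k - 1)))).
move=> n nN; pose d := k - 1; pose N := n - (l - 1).
(* [r] lies between 2 and [k] and makes [N + r] divisible by [d]: modulo [d] it is $(N+2) +
   (N+2)(d-1) = (N+2)d$. The quotient [t] is the total number of blocks, [t - r] of which avoid
   [b]. *)
pose r := 2 + ((N + 2) * (d - 1)) %% d; pose t := (N + r) %/ d.
have d2 : 2 <= d by rewrite /d; lia.
have rk : r <= k.
  by have : ((N + 2) * (d - 1)) %% d < d by [rewrite ltn_mod; lia]; rewrite /r /d; lia.
have tE : N + r = t * d.
  apply/esym/divnK.
  have -> : N + r = (N + 2) + ((N + 2) * (d - 1)) %% d by rewrite addnA.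
  rewrite /dvdn modnDmr -mulnS (_ : (d - 1).+1 = d) ?modnMl //; lia.
(* The term [k * k] in the threshold on [n] keeps [t - r] from being truncated. *)
have rt : r <= t.
  rewrite -(leq_pmul2r (ltnW d2)) -tE; apply: leq_trans (leq_addr _ _).
  apply: (@leq_trans (k * k)); last by rewrite /N; lia.
  by apply: leq_mul => //; rewrite /d leq_subr.
have cV : #|'I_n| = l - 2 + 1 + r * (k - 2) + (t - r) * (k - 1).
  rewrite card_ord.
  have e1 : t * d = (t - r) * d + r * d by rewrite -mulnDl subnK.
  have e2 : r * d = r * (k - 2) + r.
    by rewrite -mulnSr; congr (_ * _); rewrite /d; lia.
  by move: tE e1 e2; rewrite -/d /N; lia.
have [H satH cH] := saturated_upper_bound l3 k3 (leq_addr _ 2 : 2 <= r) cV.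
have [_ /(_ H satH) le] := berge_satP k n (complete_graph_neq0 (ltnW l3)).
apply: (@leq_trans ((k - 1) * #|H|)); first by rewrite leq_mul2l le orbT.
rewrite subnK // in cH.
have tn : t * (k - 1) <= n + k.
  by rewrite -/d -tE leq_add // /N leq_subr.
have e1 : 2 ^ (l - 2 + r * (k - 1)) <= 2 ^ (l - 2 + k * (k - 1)).
  by rewrite leq_exp2l // leq_add2l leq_mul2r rk orbT.
have tn' : (l - 2) * (t * (k - 1)) <= (l - 2) * (n + k) by rewrite leq_mul2l tn orbT.
apply: (@leq_trans ((k - 1) * ((l - 2) * t + 'C(l - 2, 2) + 2 ^ (l - 2 + k * (k - 1))))).
  by rewrite leq_mul2l (leq_trans cH) ?orbT // leq_add2l.
have kk : (l - 2) * k <= (l - 2) * ((k - 1) * k).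
  by rewrite leq_mul2l leq_pmull ?orbT // (ltnW d2).
move: tn' kk; clear; move: (k - 1) (l - 2) 'C(_, _) (2 ^ _) => y x c p; lia.
Qed.

Lemma berge_sat_lb (l k D : nat) : 3 <= l -> 3 <= k ->
  exists C, forall n,
    D.+1 * (l - 2) * n <=
    (D.+1 * (k - 1) + (l - 2) * k) * berge_sat k n (complete_graph l) + C.
Proof.
move=> l3 k3; exists (D.+1 * (l - 2) * (k * (D * k * (D * k)).+1)) => n.
have [[H satH <-] _] := berge_satP k n (complete_graph_neq0 (ltnW l3)).
by have := saturated_lower_bound D l3 (ltnW k3) satH; rewrite card_ord mulnDl.
Qed.

(** Relative error at most $1/E$ on both sides, cleared of denominators to stay in [nat]. *)
Lemma berge_sat_asymptotic (l k E : nat) : 3 <= l -> 3 <= k -> 0 < E ->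
  exists N, forall n, N <= n ->
    E * ((k - 1) * berge_sat k n (complete_graph l)) <= E.+1 * ((l - 2) * n) /\
    E * ((l - 2) * n) <=
      E * ((k - 1) * berge_sat k n (complete_graph l)) + (l - 2) * n.
Proof.
move=> l3 k3 E0.
have [N [C1 ub]] := berge_sat_ub l3 k3.
have a0 : 0 < l - 2 by rewrite subn_gt0.
have y0 : 0 < k - 1 by rewrite subn_gt0 ltnW.
have k0 : 0 < k by rewrite (leq_trans _ k3).
have X0 : 0 < 2 * ((l - 2) * k) by rewrite !muln_gt0 a0 k0.
have D0 : 0 < 2 * ((l - 2) * k) * E by rewrite muln_gt0 X0.
(* Here [D.+1] is $2(\ell-2)kE$. After division by $2(\ell-2)k$ the error is $s/2$ plus a constant,
   with [s] the saturation number; by the upper bound $s/2$ is at most half of $(\ell-2)n$ plus a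
   constant, and a large [n] absorbs the constants. *)
have [C2 lb] := berge_sat_lb (2 * ((l - 2) * k) * E).-1 l3 k3.
exists (N + E * C1 + C1 + C2) => n nN.
have := ub n; have := lb n; rewrite (prednK D0) => {}lb {}ub.
have {}ub : (k - 1) * berge_sat k n (complete_graph l) <= (l - 2) * n + C1.
  by apply: ub; lia.
have n1 : E * C1 + C1 + C2 <= n by lia.
move: lb ub; move: (berge_sat _ _ _) => s; clear N nN l3 k3.
move: (l - 2) (k - 1) a0 y0 X0 => a y a0 y0 X0 lb ub.
have an : n <= a * n by rewrite leq_pmull.
split.
  have h : E * (y * s) <= E * (a * n + C1) by rewrite leq_mul2l ub orbT.
  by rewrite mulSn; move: h an n1; rewrite mulnDr; lia.
have sn : a * k * s <= a * k * (a * n + C1).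
  by rewrite leq_mul2l (leq_trans _ ub) ?orbT // leq_pmull.
have an' : a * k * (C1 + C2) <= a * k * (a * n).
  by rewrite leq_mul2l (leq_trans _ an) ?orbT //; lia.
have c2 : C2 <= a * k * C2 by rewrite leq_pmull // muln_gt0 a0.
rewrite -(leq_pmul2l X0); move: lb sn an' c2.
clear; lia.
Qed.

(* Passage to real asymptotics *)
From mathcomp Require Import all_order all_algebra ring lra.
From mathcomp Require Import all_classical all_reals all_analysis.
Import Order.TTheory GRing.Theory Num.Theory.
Import numFieldNormedType.Exports.
Local Open Scope ring_scope.
Local Open Scope classical_set_scope.

Theorem theorem1p2 (R : realType) (l k : nat) (hl : (3 <= l)%N) (hk : (3 <= k)%N) :
  (fun n : nat => (berge_sat k n (complete_graph l))%:R : R^o) ~_\oo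
  (fun n : nat => (l%:R - 2) / (k%:R - 1) * n%:R : R^o).
Proof.
apply/eqaddoP => e e0.
(* [E] exceeds the inverse of [e], so a relative error of $1/E$ is at most [e]. *)
pose E := (Num.truncn e^-1).+1.
have eE : 1 <= e * E%:R.
  by rewrite -ler_pdivrMl // mulr1 ltW // truncnS_gt.
have [N hN] := @berge_sat_asymptotic l k E hl hk isT.
near=> n.
have /hN[] : (N <= n)%N by near: n; exact: nbhs_infty_ge.
rewrite -!(ler_nat R) natrD !natrM !natrB ?(ltnW hl) ?(ltnW (ltnW hk)) // -(natr1 E).
set s : R := (berge_sat _ _ _)%:R => h1 h2.
have y0 : (0 : R) < k%:R - 1 by rewrite subr_gt0 ltr1n (leq_trans _ hk).
have a0 : (0 : R) < l%:R - 2 by rewrite subr_gt0 ltr_nat.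
have n0 : (0 : R) <= n%:R := ler0n _ _.
have E0 : (0 : R) < E%:R by rewrite ltr0n.
rewrite [X in `|X| <= _](_ : _ =
    ((k%:R - 1) * s - (l%:R - 2) * n%:R) / (k%:R - 1) :> R); last first.
  rewrite -[LHS]/(s - (l%:R - 2) / (k%:R - 1) * n%:R); field.
  by rewrite gt_eqF.
have an0 : 0 <= (l%:R - 2) * n%:R :> R by rewrite mulr_ge0 // ltW.
rewrite [in leRHS]mulrAC !normrM normfV (gtr0_norm y0) mulrA ler_pM2r ?invr_gt0 //.
rewrite -normrM (ger0_norm an0).
have h3 : (l%:R - 2) * n%:R <= e * E%:R * ((l%:R - 2) * n%:R) :> R.
  by rewrite ler_peMl.
rewrite ler_norml; move: h1 h2 h3 => {an0}.
move: E%:R E0 ((_ - 1) * s) (_ * n%:R) => F E0 Y A h1 h2 h3.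
by apply/andP; split; rewrite -(ler_pM2l E0); lra.
Unshelve. all: by end_near.
Qed.
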